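(* The target pair $$H_w=(0,7,11,15),\qquad H_r=(0,4,7,10)$$ satisfies dominance and every applicable instance of the following three scalar bounds, and is not realizable. The bounds are, for $0\le m\le b_r$: (LR) $\bar H_w(n-1+m)\ge\frac{n-1}{n}H_w(n)+H_r(m)$ at every $w$-vertex $n$ with $h_n>\rho_1$; (LRb) $\bar H_w(m+1)\ge\frac1nH_w(n)+H_r(m)$ at every $w$-vertex $n\ge3$ with $h_n>\rho_1$; (PC) $\bar H_w(m+1)\ge H_r(m)+\min\{\frac{H_w(n)}{n},\frac{H_w(n)-\rho_1}{n-1}\}$ at every $w$-vertex $n\ge3$ with $\bar H_r(2)<H_w(n)-(n-2)H_w(1)$.
   Context: An instance consists of a finite set $E$ of items with rational values $a_i\ge 0$, positive integer sizes $d_i$, and integer capacities $0\le R<D$, with $d_i\le D$ for every item. Write $G(S)=\sum_{i\in S}a_i$ and $d(S)=\sum_{i\in S}d_i$. For $\alpha\in\{w,r\}$ let $U^\alpha(n)$ be the maximum of $G(S)$ over $n$-element sets $S\subseteq E$ with $d(S)\le D$ (for $\alpha=w$) or $d(S)\le R$ (for $\alpha=r$), with value $-\infty$ if there is none; $U^\alpha(0)=0$. The terminal count is $b_\alpha=\min\operatorname{arg\,max}_n U^\alpha(n)$. The hull is the sequence on $\{0,\dots,b_\alpha\}$ obtained by evaluating at integers the upper concave hull of the points $(n,U^\alpha(n))$, $0\le n\le b_\alpha$. A target pair $(H_w,H_r)$ consists of strictly increasing concave rational sequences $H_\alpha$ on $\{0,\dots,b_\alpha\}$ with $H_\alpha(0)=0$.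 It is realizable if a single instance has terminal counts $b_w,b_r$ and hulls exactly $H_w$ and $H_r$. There is no cardinality cap. Notation. $h_n=H_w(n)-H_w(n-1)$, $\rho_m=H_r(m)-H_r(m-1)$; $\bar H_\alpha(k)=H_\alpha(\min\{k,b_\alpha\})$. A positive count $n\le b_\alpha$ is an $\alpha$-vertex if $n=b_\alpha$ or the slopes of $H_\alpha$ immediately before and after $n$ differ. Dominance means $H_r(k)\le\bar H_w(k)$ for $0\le k\le b_r$. *)

(* Defs.v *)
From HB Require Import structures.
From mathcomp Require Import all_boot all_order all_algebra.
From mathcomp Require Import constructive_ereal.

Set Implicit Arguments.
Unset Strict Implicit.
Unset Printing Implicit Defensive.

Import Order.TTheory GRing.Theory Num.Theory.
Local Open Scope ring_scope.

Record instance_data := InstanceData {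
  item : finType;
  value : item -> rat;
  weight : item -> nat;
  capR : nat;
  capD : nat;
  value_ge0 : forall i, 0 <= value i;
  weight_gt0 : forall i, (0 < weight i)%N;
  capR_lt_capD : (capR < capD)%N;
  weight_le_capD : forall i, (weight i <= capD)%N
}.

Definition total_value (I : instance_data) (S : {set item I}) : rat :=
  \sum_(i in S) value i.

Definition total_weight (I : instance_data) (S : {set item I}) : nat :=
  (\sum_(i in S) weight i)%N.

(* U^w is [opt_value I (capD I)] and U^r is [opt_value I (capR I)]; the value
   is -oo when no n-element set fits, and 0 at n = 0 because of the empty set. *)
Definition opt_value (I : instance_data) (c n : nat) : \bar rat :=
  \big[maxe/-oo%E]_(S : {set item I} | (#|S| == n) && (total_weight S <= c)%N)
    (total_value S)%:E.

Definition is_argmax (u : nat -> \bar rat) (n : nat) : Prop :=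
  forall m, (u m <= u n)%E.

Definition terminal_count (u : nat -> \bar rat) (b : nat) : Prop :=
  is_argmax u b /\ forall n, is_argmax u n -> (b <= n)%N.

Definition bary_weights (b k : nat) (l : 'I_b.+1 -> rat) : Prop :=
  [/\ forall i, 0 <= l i, \sum_i l i = 1 & \sum_i l i * i%:R = k%:R].

Definition bary_value (u : nat -> \bar rat) (b : nat) (l : 'I_b.+1 -> rat)
  : \bar rat := (\sum_i (l i)%:E * u i)%E.

(* [y] is the height at abscissa [k] of the upper boundary of the convex hull
   of the points (i, u i), 0 <= i <= b.  Rational weights suffice: for rational
   points the maximum over real weights is attained at rational ones.  The
   junk convention 0 * -oo = 0 is never used when [b] is a terminal count of
   [opt_value I c], whose values are then finite on 0, ..., b. *)
Definition upper_hull_at (u : nat -> \bar rat) (b k : nat) (y : rat) : Prop :=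
  (exists l : 'I_b.+1 -> rat, bary_weights k l /\ bary_value u l = y%:E) /\
  (forall l : 'I_b.+1 -> rat, bary_weights k l -> (bary_value u l <= y%:E)%E).

(* A sequence (H(0), ..., H(b)) is a list of size b + 1. *)
Definition last_index (H : seq rat) : nat := (size H).-1.

Definition has_hull (u : nat -> \bar rat) (H : seq rat) : Prop :=
  terminal_count u (last_index H) /\
  forall k, (k <= last_index H)%N -> upper_hull_at u (last_index H) k H`_k.

Definition target_seq (H : seq rat) : Prop :=
  [/\ (0 < size H)%N,
      H`_0 = 0,
      forall n, (n < last_index H)%N -> H`_n < H`_n.+1
    & forall n, (0 < n < last_index H)%N -> H`_n.+1 - H`_n <= H`_n - H`_n.-1].

Definition target_pair (Hw Hr : seq rat) : Prop :=
  target_seq Hw /\ target_seq Hr.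

Definition realizable (Hw Hr : seq rat) : Prop :=
  exists I : instance_data,
    has_hull (opt_value I (capD I)) Hw /\ has_hull (opt_value I (capR I)) Hr.

(* The slope just before [n]; meaningful for 1 <= n <= last_index H. *)
Definition slope (H : seq rat) (n : nat) : rat := H`_n - H`_n.-1.

Definition extend (H : seq rat) (k : nat) : rat := H`_(minn k (last_index H)).

Definition vertex (H : seq rat) (n : nat) : Prop :=
  (0 < n <= last_index H)%N /\
  (n = last_index H \/ slope H n <> slope H n.+1).

Definition dominance (Hw Hr : seq rat) : Prop :=
  forall k, (k <= last_index Hr)%N -> Hr`_k <= extend Hw k.

Definition LR (Hw Hr : seq rat) : Prop :=
  forall n m, vertex Hw n -> slope Hr 1%N < slope Hw n ->
    (m <= last_index Hr)%N ->
    (n - 1)%N%:R / n%:R * Hw`_n + Hr`_m <= extend Hw (n - 1 + m)%N.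

Definition LRb (Hw Hr : seq rat) : Prop :=
  forall n m, vertex Hw n -> (3 <= n)%N -> slope Hr 1%N < slope Hw n ->
    (m <= last_index Hr)%N ->
    1 / n%:R * Hw`_n + Hr`_m <= extend Hw (m + 1)%N.

Definition PC (Hw Hr : seq rat) : Prop :=
  forall n m, vertex Hw n -> (3 <= n)%N ->
    extend Hr 2%N < Hw`_n - (n - 2)%N%:R * Hw`_1 ->
    (m <= last_index Hr)%N ->
    Hr`_m + Num.min (Hw`_n / n%:R) ((Hw`_n - slope Hr 1%N) / (n - 1)%N%:R)
      <= extend Hw (m + 1)%N.

(* Main.v *)
Require Import Defs.
From mathcomp Require Import all_boot all_order all_algebra.
From mathcomp Require Import constructive_ereal lra.

Import Order.TTheory GRing.Theory Num.Theory.
Local Open Scope ring_scope.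

(** The finitely many inequalities are checked by evaluation; the content is
    non-realizability.  Suppose an instance realizes the pair.  Only the
    following traces of the hulls matter.
    - A set that fits in capacity D has value at most 15, every item has value
      at most 7, and some three-item set W fits in D with value exactly 15.
    - A single item of size at most R has value at most 4, a pair of total size
      at most R has value at most 7, and some set T of size at most R has
      value 10.

    Let x in W have value more than 4.  Then x is too large for R, so x is not
    in T.  The pair W - x cannot fit in R, for its value would be at most 7 and
    x would be worth at least 8.  So T is no larger than W - x, the set x + T
    fits in D, and its value, that of x plus 10, is at most 15: x is worth at
    most 5 ([large_item_le5]).  Thus every item of W is worth at most 5, and as
    the three add up to 15, each is worth exactly 5.  Each of them is then
    larger than R, hence outside T, and replacing a single one by T gives a set
    that fits in D with value 15 - 5 + 10 = 20, which exceeds 15.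

    The contradiction thus combines two exchanges against the same T, of a pair
    of items of W and of a single item of W. *)

(** * Reading the optimal values off a hull *)

Lemma bary_weights_delta b (k : 'I_b.+1) :
  bary_weights k (fun i => (i == k)%:R).
Proof.
split=> [i||]; first by rewrite ler0n.
  by rewrite (bigD1 k) //= eqxx big1 ?addr0 // => i /negbTE ->.
rewrite (bigD1 k) //= eqxx mul1r big1 ?addr0 // => i /negbTE ->.
by rewrite mul0r.
Qed.

(** The terms other than [k] vanish even where [u] is infinite, since
    0 * -oo = 0. *)
Lemma bary_value_delta u b (k : 'I_b.+1) (l : 'I_b.+1 -> rat) :
  l k = 1 -> (forall i, i != k -> l i = 0) -> bary_value u l = u k.
Proof.
move=> lk l0; rewrite /bary_value (bigD1 k) //= lk mul1e big1 ?adde0 // => i ik.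
by rewrite l0 // mul0e.
Qed.

Lemma le_upper_hull u b k y :
  (k <= b)%N -> upper_hull_at u b k y -> (u k <= y%:E)%E.
Proof.
move=> kb [_ hull_le]; pose j : 'I_b.+1 := Ordinal (kb : (k < b.+1)%N).
have := hull_le _ (bary_weights_delta b j).
by rewrite (bary_value_delta _ _ j) ?eqxx // => i /negbTE ->.
Qed.

(** The last abscissa is an extreme point of [0, b]: the only barycentric
    weights centred there are concentrated there, so the hull meets the
    sequence. *)
Lemma upper_hull_last u b y : upper_hull_at u b b y -> u b = y%:E.
Proof.
case=> -[l [[l_ge0 l_sum l_bary] <-]] _.
have gap_ge0 (i : 'I_b.+1) : 0 <= l i * (b%:R - i%:R).
  by rewrite mulr_ge0 // subr_ge0 ler_nat -ltnS.
have gap_sum : \sum_i l i * (b%:R - i%:R) = 0.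
  under eq_bigr do rewrite mulrBr.
  by rewrite sumrB l_bary -mulr_suml l_sum mul1r subrr.
have l0 (i : 'I_b.+1) : i != ord_max -> l i = 0.
  move=> i_max; have /eqP := gap_sum.
  rewrite psumr_eq0 // => /allP /(_ i); rewrite mem_index_enum => /(_ isT).
  rewrite mulf_eq0 subr_eq0 eqr_nat => /orP[/eqP //|/eqP ib].
  by move: i_max; rewrite -val_eqE /= -ib eqxx.
rewrite (bary_value_delta _ _ ord_max) //.
by move: l_sum; rewrite (bigD1 ord_max) //= big1 ?addr0.
Qed.

Section OptValue.
Variables (I : instance_data) (c : nat).
Implicit Types S : {set item I}.

Lemma total_value_le_opt S : (total_weight S <= c)%N ->
  ((total_value S)%:E <= opt_value I c #|S|)%E.
Proof.
move=> Sc.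
by apply: (le_bigmax_cond _ (fun S => (total_value S)%:E)); rewrite eqxx.
Qed.

Lemma opt_value_attained n y : opt_value I c n = y%:E ->
  exists S, [/\ #|S| = n, (total_weight S <= c)%N & total_value S = y].
Proof.
have: opt_value I c n = -oo%E \/ exists S,
    [/\ #|S| = n, (total_weight S <= c)%N & (total_value S)%:E = opt_value I c n].
  rewrite /opt_value; elim/big_ind: _ => [|x z Px Pz|S /andP[/eqP Sn Sc]].
  - by left.
  - by rewrite /Order.max; case: ifP.
  - by right; exists S.
by case=> [->//|[S [Sn Sc <-]] [Sy]]; exists S.
Qed.

Lemma has_hull_total_value_le (H : seq rat) S :
    has_hull (opt_value I c) H -> (#|S| <= last_index H)%N ->
  (total_weight S <= c)%N -> total_value S <= H`_#|S|.
Proof.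
move=> [_ hull] Sb /total_value_le_opt Sc.
by rewrite -lee_fin (le_trans Sc) // (le_upper_hull _ _ _ _ Sb) //; apply: hull.
Qed.

Lemma has_hull_opt_last (H : seq rat) : has_hull (opt_value I c) H ->
  opt_value I c (last_index H) = (H`_(last_index H))%:E.
Proof. by case=> _ hull; apply/upper_hull_last/hull. Qed.

Lemma has_hull_total_value_le_last (H : seq rat) S :
    has_hull (opt_value I c) H -> (total_weight S <= c)%N ->
  total_value S <= H`_(last_index H).
Proof.
move=> hullH /total_value_le_opt Sc; rewrite -lee_fin (le_trans Sc) //.
by rewrite -(has_hull_opt_last H) //; case: hullH => -[].
Qed.

End OptValue.

(** * Exchanging part of a set *)

Section Exchange.
Context {I : instance_data}.
Implicit Types S T A : {set item I}.

Lemma total_valueU S T : [disjoint S & T] ->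
  total_value (S :|: T) = total_value S + total_value T.
Proof. by move=> ST; rewrite /total_value -bigU //; apply: eq_bigl => i; rewrite !inE. Qed.

Lemma total_weightU S T : [disjoint S & T] ->
  total_weight (S :|: T) = (total_weight S + total_weight T)%N.
Proof. by move=> ST; rewrite /total_weight -bigU //; apply: eq_bigl => i; rewrite !inE. Qed.

Lemma total_value1 (x : item I) : total_value [set x] = value x.
Proof. by rewrite /total_value big_set1. Qed.

Lemma total_weight1 (x : item I) : total_weight [set x] = weight x.
Proof. by rewrite /total_weight big_set1. Qed.

Lemma total_valueD1 S x : x \in S ->
  total_value S = value x + total_value (S :\ x).
Proof. by move=> xS; rewrite /total_value (big_setD1 x). Qed.

Lemma total_weightD1 S x : x \in S ->
  total_weight S = (weight x + total_weight (S :\ x))%N.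
Proof. by move=> xS; rewrite /total_weight (big_setD1 x). Qed.

Lemma weight_le_total S x : x \in S -> (weight x <= total_weight S)%N.
Proof. by move=> /total_weightD1->; rewrite leq_addr. Qed.

End Exchange.

(** * The pair is not realizable *)

Section NotRealizable.
Context {I : instance_data}.
Hypothesis hull_w : has_hull (opt_value I (capD I)) [:: 0; 7; 11; 15].
Hypothesis hull_r : has_hull (opt_value I (capR I)) [:: 0; 4; 7; 10].
Implicit Types S T W : {set item I}.

Lemma value_le7 (x : item I) : value x <= 7.
Proof.
have := has_hull_total_value_le _ _ _ [set x] hull_w.
by rewrite cards1 total_weight1 total_value1 => /(_ isT (weight_le_capD x)).
Qed.

Lemma value_le4 (x : item I) : (weight x <= capR I)%N -> value x <= 4.
Proof.
have := has_hull_total_value_le _ _ _ [set x] hull_r.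
by rewrite cards1 total_weight1 total_value1 => /(_ isT).
Qed.

(** An item worth more than 4 is too large for capacity R, hence outside every
    set that fits there. *)
Lemma large_item_notin T x :
  (total_weight T <= capR I)%N -> 4 < value x -> x \notin T.
Proof.
move=> Tr x_gt4; apply/negP => /weight_le_total xT.
by have := value_le4 x (leq_trans xT Tr); lra.
Qed.

(** Exchange of the pair of other items of [W] against [T]. *)
Lemma large_item_le5 W T x :
    #|W| = 3%N -> (total_weight W <= capD I)%N -> total_value W = 15 ->
    (total_weight T <= capR I)%N -> total_value T = 10 ->
  x \in W -> value x <= 5.
Proof.
move=> W3 Wd W15 Tr T10 xW; case: (lerP (value x) 4) => [|x_gt4]; first by lra.
have card_pair : #|W :\ x| = 2%N by move: W3; rewrite (cardsD1 x) xW => -[].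
have pair_gtR : (capR I < total_weight (W :\ x))%N.
  rewrite ltnNge; apply/negP => pair_r.
  have := has_hull_total_value_le _ _ _ (W :\ x) hull_r.
  rewrite card_pair => /(_ isT pair_r) /= pair_le7.
  by have := value_le7 x; have := total_valueD1 W x xW; lra.
have xT : [disjoint [set x] & T] by rewrite disjoints1 large_item_notin.
have := has_hull_total_value_le_last _ _ _ ([set x] :|: T) hull_w.
rewrite total_weightU // total_valueU // total_weight1 total_value1 T10 /=.
suff fits : (weight x + total_weight T <= capD I)%N by move=> /(_ fits); lra.
apply: leq_trans Wd; rewrite (total_weightD1 W x) // leq_add2l.
by rewrite (leq_trans Tr) // ltnW.
Qed.

Lemma hulls_absurd : False.
Proof.
have [W [W3 Wd W15]] := opt_value_attained _ _ _ _ (has_hull_opt_last _ _ _ hull_w).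
have [T [_ Tr T10]] := opt_value_attained _ _ _ _ (has_hull_opt_last _ _ _ hull_r).
rewrite /last_index /= in W3 W15 T10.
have le5 x : x \in W -> value x <= 5 by apply: large_item_le5 W3 Wd W15 Tr T10.
have eq5 x : x \in W -> value x = 5.
  move=> xW; apply/eqP; rewrite -subr_eq0 -oppr_eq0 opprB.
  (* The slacks 5 - value z are nonnegative on W and add up to 3 * 5 - 15. *)
  have slack0 : \sum_(z in W) (5 - value z) = 0.
    rewrite sumrB -[X in _ - X]/(total_value W) W15 sumr_const W3.
    by rewrite -mulr_natr; lra.
  have /eqP := slack0; rewrite psumr_eq0 => [|z /le5]; last by lra.
  by move=> /allP /(_ x); rewrite mem_index_enum xW => /(_ isT).
have [x xW] : exists x, x \in W by apply/card_gt0P; rewrite W3.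
have WT : [disjoint W :\ x & T].
  apply/pred0P => z /=; apply/negP => /andP[/setD1P[_ zW]].
  by apply/negP/large_item_notin => //; rewrite eq5.
have := has_hull_total_value_le_last _ _ _ ((W :\ x) :|: T) hull_w.
rewrite total_weightU // total_valueU // T10 /=.
have x_gtR : (capR I < weight x)%N.
  by rewrite ltnNge; apply/negP => /value_le4; rewrite eq5.
suff fits : (total_weight (W :\ x) + total_weight T <= capD I)%N.
  by move=> /(_ fits); have := total_valueD1 W x xW; rewrite W15 eq5 //; lra.
apply: leq_trans Wd; rewrite (total_weightD1 W x) // addnC leq_add2r.
by rewrite (leq_trans Tr) // ltnW.
Qed.

End NotRealizable.

Theorem theorem4p6 :
  let Hw : seq rat := [:: 0; 7; 11; 15] in
  let Hr : seq rat := [:: 0; 4; 7; 10] in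
  target_pair Hw Hr /\
  dominance Hw Hr /\
  LR Hw Hr /\
  LRb Hw Hr /\
  PC Hw Hr /\
  ~ realizable Hw Hr.
Proof.
move=> Hw Hr.
(* The slopes of H_w are 7, 4, 4, and the first slope of H_r is 4. *)
have steep_vertex n : vertex Hw n -> slope Hr 1%N < slope Hw n -> n = 1%N.
  case=> + _; case: n => [|[|[|[|n]]]] range steep //; by vm_compute in steep.
split; [|split; [|split; [|split; [|split]]]].
- by split; split=> // -[|[|[|n]]].
- by case=> [|[|[|[|k]]]] k_le //; vm_compute.
- (* At n = 1 the bound is dominance. *)
  move=> n m vertex_n /(steep_vertex _ vertex_n)->.
  by case: m => [|[|[|[|m]]]] m_le //; vm_compute.
- by move=> n m vertex_n + /(steep_vertex _ vertex_n) n1; rewrite n1.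
- (* Only n = 3 qualifies, where the minimum is 15 / 3 = 5; the bound is tight
     for m = 3. *)
  move=> n m [/andP[_ n_le3] _] n_ge3 _.
  have -> : n = 3%N by apply/eqP; rewrite eqn_leq n_le3.
  by case: m => [|[|[|[|m]]]] m_le //; vm_compute.
- by case=> I [hull_w hull_r]; exact: hulls_absurd hull_w hull_r.
Qed.
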